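(* Let $G$ be a crossword grid with $N \geq 1$ white squares and $a$ across words, and let $\operatorname{RP}(G)$ be the set of complete non-attacking rook placements on $G$. Then $$|\operatorname{RP}(G)| \leq \left[ \left(\frac{N}{a}\right)^{1 + a/N} e^{a/N - 1}\right]^a \leq e^{CN},$$ where $C \approx 0.27386$ is the unique maximum value of the function $f(x) = -x\ln(x) - x^2\ln(x) - x + x^2$ on the interval $(0,1)$.
   Context: An $m \times n$ crossword grid ($m,n$ positive integers) is an $m\times n$ array of squares, each of which is white or black; no symmetry, connectedness or minimum word length conditions are imposed. An across word is a maximal (non-empty) contiguous sequence of white squares within a single row; a down word is a maximal (non-empty) contiguous sequence of white squares within a single column. A complete non-attacking rook placement on $G$ is a subset $R$ of the white squares of $G$ containing exactly one square of every across word and exactly one square of every down word. $\operatorname{RP}(G)$ denotes the set of all complete non-attacking rook placements on $G$. *)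

(* Defs.v *)
From mathcomp Require Import all_boot all_order all_algebra.

Set Implicit Arguments.
Unset Strict Implicit.
Unset Printing Implicit Defensive.

Import Order.TTheory GRing.Theory Num.Theory.

(* [G i j = true] iff the square in row [i], column [j] is white. *)
Definition grid (m n : nat) := 'M[bool]_(m, n).

Section Crossword.
Variables m n : nat.
Implicit Types (G : grid m n) (W R : {set 'I_m * 'I_n}).

Definition white G : {set 'I_m * 'I_n} := [set s | G s.1 s.2].

Definition row_segment (i : 'I_m) (j k : 'I_n) : {set 'I_m * 'I_n} :=
  [set s : 'I_m * 'I_n | (s.1 == i) && (j <= s.2 <= k)%N].

Definition col_segment (j : 'I_n) (i k : 'I_m) : {set 'I_m * 'I_n} :=
  [set s : 'I_m * 'I_n | (s.2 == j) && (i <= s.1 <= k)%N].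

Definition white_row_run G W : bool :=
  [&& W != set0, W \subset white G &
      [exists i : 'I_m, exists j : 'I_n, exists k : 'I_n,
         W == row_segment i j k]].

Definition white_col_run G W : bool :=
  [&& W != set0, W \subset white G &
      [exists j : 'I_n, exists i : 'I_m, exists k : 'I_m,
         W == col_segment j i k]].

Definition across_words G : {set {set 'I_m * 'I_n}} :=
  [set W | maxset (white_row_run G) W].

Definition down_words G : {set {set 'I_m * 'I_n}} :=
  [set W | maxset (white_col_run G) W].

Definition complete_rook_placement G R : bool :=
  [&& R \subset white G,
      [forall W in across_words G, #|R :&: W| == 1%N] &
      [forall W in down_words G, #|R :&: W| == 1%N]].

Definition RP G : {set {set 'I_m * 'I_n}} :=
  [set R | complete_rook_placement G R].

End Crossword.

(* Imported only here: classical_sets shadows finset names such as [set0]. *)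
From mathcomp Require Import reals sequences exp.

Local Open Scope ring_scope.

Section Maximum.
Variable R : realType.

Definition rook_exponent (x : R) : R := - x * ln x - x ^+ 2 * ln x - x + x ^+ 2.

(* [C] is the maximum of [g] on the open interval (a, b), attained at exactly
   one point. *)
Definition unique_max_on (g : R -> R) (a b C : R) : Prop :=
  exists x0 : R, [/\ a < x0 < b, g x0 = C &
    forall x : R, a < x < b -> x != x0 -> g x < C].

End Maximum.

(* Main.v *)
Require Import Defs.
From mathcomp Require Import all_boot all_order all_algebra.
From mathcomp Require Import reals sequences exp.
From mathcomp Require Import boolp functions topology normedtype derive realfun.
From mathcomp Require Import ring lra zify.

Import Order.TTheory GRing.Theory Num.Theory.
Import numFieldNormedType.Exports.
Local Open Scope ring_scope.

(** Sending a white square to the pair (across word, down word) through it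
    identifies rook placements with perfect matchings of a bipartite graph in
    which an across word W has degree #|W|. Schrijver's proof of Bregman's
    theorem bounds ln of the number of perfect matchings by the sum of h #|W|
    for every h with r h(r) + ln (r + 1) <= (r + 1) h(r + 1). One such h is
    h(r) = r f(1/r), where f is [rook_exponent]. Since f is strictly concave,
    its tangent at a/N gives sum_W h #|W| <= N f(a/N), and N f(a/N) is exactly
    the logarithm of the stated bound. *)

(** * Deletion in injective images, and convexity of x ln x *)

Lemma imsetD1_inj (T U : finType) (f : T -> U) (M : {set T}) (s : T) :
  {in M &, injective f} -> s \in M -> f @: (M :\ s) = (f @: M) :\ f s.
Proof.
move=> finj sM; apply/setP => y; rewrite in_setD1; apply/imsetP/andP.
- case=> t; rewrite in_setD1 => /andP[ts tM] ->; split; last exact: imset_f.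
  by apply: contra ts => /eqP /finj -> .
- case=> yfs /imsetP[t tM yE]; exists t => //.
  by rewrite in_setD1 tM andbT; apply: contra yfs => /eqP <-; rewrite yE.
Qed.

(** Jensen's inequality for x ln x with denominators cleared. It follows from ln u <= u - 1 at u = P
    / ([#|A|] * x t), because the bounds P / [#|A|] - x t sum to zero. *)
Lemma xlnx_sum_le (R : realType) (T : finType) (A : {set T}) (x : T -> R) (P : R) :
  {in A, forall t, 0 <= x t} -> \sum_(t in A) x t = P ->
  P * ln P <= P * ln #|A|%:R + \sum_(t in A) x t * ln (x t).
Proof.
move=> x0 defP.
have P0 : 0 <= P by rewrite -defP sumr_ge0.
have [P_gt0|] := ltP 0 P; last first.
  move=> P0'; have PE : P = 0 by apply/eqP; rewrite eq_le P0 P0'.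
  rewrite PE !mul0r add0r.
  rewrite big1 // => t tA.
  move/eqP: defP; rewrite PE psumr_eq0 // => /allP/(_ t).
  by rewrite mem_index_enum tA => /(_ isT)/eqP ->; rewrite mul0r.
have A0 : (0 < #|A|)%N.
  rewrite card_gt0; apply: contraTneq P_gt0 => A0; rewrite -defP A0 big_set0 ltxx //.
have dpos : 0 < #|A|%:R :> R by rewrite ltr0n.
suff : \sum_(t in A) x t * (ln P - ln #|A|%:R - ln (x t)) <= \sum_(t in A) (P / #|A|%:R - x t).
  rewrite [leRHS]big_split /= sumr_const sumrN defP -(mulr_natr (P / #|A|%:R)) divfK ?gt_eqF// subrr.
  have -> : \sum_(t in A) x t * (ln P - ln #|A|%:R - ln (x t)) =
     P * (ln P - ln #|A|%:R) - \sum_(t in A) x t * ln (x t).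
    rewrite -defP mulr_suml -sumrB; apply: eq_bigr => t _; ring.
  by rewrite mulrBr; lra.
apply: ler_sum => t tA.
have := x0 t tA; rewrite le_eqVlt => /predU1P[<-|xt0].
  by rewrite mul0r subr0 divr_ge0// ltW.
have := @le_ln1Dx R (P / #|A|%:R / x t - 1).
have u0 : 0 < P / #|A|%:R / x t by rewrite !divr_gt0.
rewrite addrCA subrr addr0 => /(_ ltac:(lra)).
rewrite !ln_div ?posrE ?divr_gt0// => H.
have := ler_wpM2l (ltW xt0) H.
rewrite !mulrBr mulr1 mulrCA divff ?gt_eqF// mulr1; lra.
Qed.

(** * Perfect matchings of a bipartite graph and Schrijver's argument *)

Section Matchings.
Variables (S I J : finType) (F : {set S}) (p : S -> I) (q : S -> J).

(** Edges are abstract points with ends [p] and [q], so that white squares can serve as edges.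
    Equality of cardinals is the boolean form of injectivity. *)
Definition pmatchings (A : {set I}) (B : {set J}) : {set {set S}} :=
  [set M : {set S} | [&& M \subset F, p @: M == A, q @: M == B,
     #|p @: M| == #|M| & #|q @: M| == #|M|]].

(** Shrinking [B] while [F] stays fixed gives the edges at [i] in a minor. *)
Definition edges_at (B : {set J}) (i : I) : {set S} :=
  [set s in F | (p s == i) && (q s \in B)].

Lemma pmatchingsP (A : {set I}) (B : {set J}) (M : {set S}) :
  reflect [/\ M \subset F, p @: M = A, q @: M = B,
              {in M &, injective p} & {in M &, injective q}]
          (M \in pmatchings A B).
Proof.
rewrite inE; apply: (iffP and5P) => -[MF pM qM pi qi]; split => //.
- exact/eqP.
- exact/eqP.
- exact/imset_injP.
- exact/imset_injP.
- exact/eqP.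
- exact/eqP.
- exact/imset_injP.
- exact/imset_injP.
Qed.

Lemma pmatchings_edge {A : {set I}} {B : {set J}} {M : {set S}} {s : S} :
  M \in pmatchings A B -> s \in M -> [/\ s \in F, p s \in A & q s \in B].
Proof.
case/pmatchingsP=> /subsetP MF <- <- _ _ sM.
by rewrite MF ?imset_f.
Qed.

Lemma pmatchings_card {A : {set I}} {B : {set J}} {M : {set S}} :
  M \in pmatchings A B -> #|M| = #|A| /\ #|M| = #|B|.
Proof. by case/pmatchingsP=> _ <- <- pi qi; rewrite !card_in_imset. Qed.

Lemma pmatchingsD1 (A : {set I}) (B : {set J}) (M : {set S}) (s : S) :
  M \in pmatchings A B -> s \in M ->
  M :\ s \in pmatchings (A :\ p s) (B :\ q s).
Proof.
case/pmatchingsP=> MF pM qM pi qi sM; have sub := subD1set M s.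
apply/pmatchingsP; split; first exact: subset_trans MF.
- by rewrite imsetD1_inj ?pM.
- by rewrite imsetD1_inj ?qM.
- by move=> t u /(subsetP sub) tM /(subsetP sub) uM; apply: pi.
- by move=> t u /(subsetP sub) tM /(subsetP sub) uM; apply: qi.
Qed.

(** Removing [s] is injective on the matchings through [s] and leaves a matching of the minor
    without the two ends of [s]. *)
Lemma card_pmatchings_edge (A : {set I}) (B : {set J}) (s : S) :
  (#|[set M in pmatchings A B | s \in M]| <=
   #|pmatchings (A :\ p s) (B :\ q s)|)%N.
Proof.
rewrite -(@card_in_imset _ _ (fun M => M :\ s)).
  apply/subset_leq_card/subsetP => _ /imsetP[M + ->].
  by rewrite inE => /andP[MP sM]; exact: pmatchingsD1.
move=> M N; rewrite !inE => /andP[_ sM] /andP[_ sN] MN.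
by rewrite -(setD1K sM) MN setD1K.
Qed.

Lemma pmatchings_row {A : {set I}} {B : {set J}} {M : {set S}} {i : I} :
  M \in pmatchings A B -> i \in A ->
  exists2 s, s \in M & [set t in edges_at B i | t \in M] = [set s].
Proof.
move=> MP iA; have [MF pM qM pi qi] := pmatchingsP _ _ _ MP.
move: iA; rewrite -pM => /imsetP[s sM iE]; exists s => //.
apply/setP => t; rewrite !inE; apply/andP/eqP => [[/and3P[_ /eqP pt _] tM]|->].
  by apply: pi; rewrite ?pt.
have [-> _ ->] := pmatchings_edge MP sM.
by rewrite iE eqxx.
Qed.

(** Analogue of expanding a permanent along a row: every matching has exactly one edge at [i], so
    double counting applies. *)
Lemma sum_card_pmatchings_edge (A : {set I}) (B : {set J}) (i : I) : i \in A ->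
  (\sum_(s in edges_at B i) #|[set M in pmatchings A B | s \in M]| =
   #|pmatchings A B|)%N.
Proof.
move=> iA.
under eq_bigr => s _.
  rewrite -sum1_card (eq_bigl (fun M => (M \in pmatchings A B) && (s \in M))).
    over.
  by move=> M; rewrite inE.
rewrite (exchange_big_dep (fun M => M \in pmatchings A B)) /=; last by move=> s M _ /andP[].
rewrite -[RHS]sum1_card; apply: eq_bigr => M MP.
have [s _ E] := pmatchings_row MP iA.
rewrite sum1_card -(cards1 s) -E; apply: eq_card => t.
by rewrite [in RHS]inE unfold_in /= MP.
Qed.

(** No parallel edges, so the degree of a row counts its neighbouring columns. *)
Hypothesis pq_inj :
  {in F &, forall s t, p s = p t -> q s = q t -> s = t}.

Lemma edges_at_inj (B : {set J}) (i : I) : {in edges_at B i &, injective q}.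
Proof.
move=> s t; rewrite !inE => /and3P[sF /eqP si _] /and3P[tF /eqP ti _].
by apply: pq_inj => //; rewrite si ti.
Qed.

Lemma card_edges_atD1 (B : {set J}) (i : I) (j : J) :
  #|edges_at (B :\ j) i| = (#|edges_at B i| - (j \in q @: edges_at B i))%N.
Proof.
have inj := edges_at_inj B i.
case: imsetP => [[s sE ->]|nj].
  rewrite (cardsD1 s (edges_at B i)) sE /= addnC addnK; apply: eq_card => t.
  rewrite !inE; have [->|ts] := eqVneq t s; first by rewrite eqxx !andbF.
  have [tE|] := boolP (t \in edges_at B i); last first.
    by rewrite inE /=; case: (t \in F) (p t == i) (q t \in B) => [] [] []; rewrite ?andbF.
  have -> : q t != q s by apply: contra ts => /eqP /inj ->.
  by [].
rewrite subn0; apply: eq_card => t; rewrite !inE.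
have [qt|//] := eqVneq (q t) j.
rewrite !andbF; apply/esym/negP => tE; apply: nj; exists t => //.
by rewrite inE.
Qed.

Variable R : realType.

(** With d the degree of [k], regrouping by columns gives d - 1 terms h(d - 1) and [#|A|] - d terms
    h(d). The recursion on [h] absorbs ln d + (d - 1) h(d - 1) into d h(d). *)
Lemma sum_minor_weights (h : nat -> R) (A : {set I}) (B : {set J})
    (M : {set S}) (k : I) :
  M \in pmatchings A B -> k \in A ->
  (forall r, r%:R * h r + ln r.+1%:R <= r.+1%:R * h r.+1) ->
  ln #|edges_at B k|%:R +
    \sum_(s in M | p s != k) h #|edges_at (B :\ q s) k| <=
  #|A|%:R * h #|edges_at B k|.
Proof.
move=> MP kA hh.
have [MF pM qM pi qi] := pmatchingsP _ _ _ MP.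
have inj := edges_at_inj B k.
set d := #|edges_at B k|; set N := q @: edges_at B k.
have dN : #|N| = d by rewrite card_in_imset.
have [s0 s0M E0] := pmatchings_row MP kA.
have [s0E ps0] : s0 \in edges_at B k /\ p s0 = k.
  have : s0 \in [set t in edges_at B k | t \in M] by rewrite E0 set11.
  by rewrite inE => /andP[s0E _]; split => //; move: s0E; rewrite inE => /and3P[_ /eqP].
have NB : N \subset B.
  by apply/subsetP => _ /imsetP[t + ->]; rewrite inE => /and3P[].
have cAB : #|A| = #|B| by have [<- <-] := pmatchings_card MP.
(* Deleting the column of [s] lowers the degree of row [k] by one exactly when
   that column meets [k]: this happens for [d - 1] of the edges of [M] outside
   row [k]. *)
have -> : \sum_(s in M | p s != k) h #|edges_at (B :\ q s) k| =
    \sum_(j in B :\ q s0) h (d - (j \in N))%N.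
  have -> : B :\ q s0 = q @: (M :\ s0) by rewrite imsetD1_inj // qM.
  rewrite big_imset /=; last first.
    by move=> t u /setD1P[_ tM] /setD1P[_ uM]; apply: qi.
  apply: eq_big => [s|s _]; last by rewrite card_edges_atD1.
  rewrite in_setD1 andbC; have [sM|] := boolP (s \in M); last by rewrite !andbF.
  rewrite !andbT; apply/idP/idP; apply: contra => /eqP.
    by move=> ->; rewrite ps0.
  by move=> psk; apply/eqP/pi => //; rewrite psk ps0.
have qN : q s0 \in N by exact: imset_f.
rewrite (big_setID N) /=.
have -> : (B :\ q s0) :&: N = N :\ q s0.
  by rewrite setIDAC (setIidPr NB).
have -> : (B :\ q s0) :\: N = B :\: N.
  apply/setP => j; rewrite !inE; have [->|] := eqVneq j (q s0) => //=.
  by rewrite qN.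
rewrite (eq_bigr (fun=> h d.-1)); last first.
  by move=> j /setD1P[_ ->]; rewrite subn1.
rewrite [X in _ + (_ + X)](eq_bigr (fun=> h d)); last first.
  by move=> j; rewrite in_setD => /andP[/negbTE ->]; rewrite subn0.
rewrite !sumr_const -[h d.-1 *+ _]mulr_natl -[h d *+ _]mulr_natl (cardsD B N) (setIidPr NB) dN -cAB.
have -> : #|N :\ q s0| = d.-1 by rewrite -dN (cardsD1 (q s0) N) qN.
have dA : (d <= #|A|)%N by rewrite -dN cAB subset_leq_card.
(* The edge [s0] makes [d] positive, so the recursion applies at [r = d.-1]. *)
have d0 : (0 < d)%N by rewrite card_gt0; apply/set0Pn; exists s0.
rewrite natrB //; have := hh d.-1; rewrite prednK // mulrBl; lra.
Qed.

(* Equality in the recursion gives [h r = ln r`! / r], which is Bregman's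
   bound on the permanent. *)
Lemma ln_card_pmatchings_le (h : nat -> R) (A : {set I}) (B : {set J}) :
  (forall r, r%:R * h r + ln r.+1%:R <= r.+1%:R * h r.+1) ->
  (0 < #|pmatchings A B|)%N ->
  ln #|pmatchings A B|%:R <= \sum_(i in A) h #|edges_at B i|.
Proof.
move=> hh; move cA : #|A| => n; elim: n A B cA => [|n IH] A B cA P0.
  have A0 : A = set0 by apply/eqP; rewrite -cards_eq0 cA.
  (* With no rows left, only the empty set can be a matching, so the count is at most 1. *)
  rewrite A0 big_set0 ln_le0 // lern1 -(cards1 (@set0 S)).
  apply/subset_leq_card/subsetP => M /pmatchings_card[+ _].
  by rewrite cards0 => /eqP; rewrite cards_eq0 inE.
set P := #|pmatchings A B|; pose c s := #|[set M in pmatchings A B | s \in M]|.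
have P0R : 0 < P%:R :> R by rewrite ltr0n.
(* The factor [n.+1 * P] allows the left side to be summed over the rows and the right side over the
   matchings. *)
rewrite -(ler_pM2l (_ : 0 < n.+1%:R * P%:R)); last by rewrite mulr_gt0 ?ltr0n.
(* [P ^ P <= d_i ^ P * \prod_s c_s ^ c_s] for each row [i], where [s] runs over
   the edges at [i]; the product over all rows is then regrouped as a product
   over pairs [s \in M]. *)
have row i : i \in A -> P%:R * ln P%:R <=
    P%:R * ln #|edges_at B i|%:R + \sum_(s in edges_at B i) (c s)%:R * ln (c s)%:R :> R.
  move=> iA; have := @xlnx_sum_le R S (edges_at B i) (fun s => (c s)%:R) P%:R.
  by apply => //; rewrite -natr_sum sum_card_pmatchings_edge.
apply: (@le_trans _ _ (\sum_(i in A) (P%:R * ln #|edges_at B i|%:R +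
   \sum_(s in edges_at B i) (c s)%:R * ln (c s)%:R))).
  rewrite -mulrA mulr_natl -cA -sumr_const; exact: ler_sum.
have swap : \sum_(i in A) \sum_(s in edges_at B i) (c s)%:R * ln (c s)%:R =
   \sum_(M in pmatchings A B) \sum_(s in M) ln (c s)%:R :> R.
  transitivity (\sum_(i in A) \sum_(M in pmatchings A B)
      \sum_(s in edges_at B i | s \in M) ln (c s)%:R : R).
    apply: eq_bigr => i iA.
    under eq_bigr => s _.
      rewrite mulr_natl -sumr_const (eq_bigl (fun M => (M \in pmatchings A B) && (s \in M))).
        over.
      by move=> M; rewrite inE.
    rewrite (exchange_big_dep (fun M => M \in pmatchings A B)) /=; last by move=> s M _ /andP[].
    apply: eq_bigr => M MP; apply: eq_bigl => s; by rewrite MP.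
  rewrite exchange_big /=; apply: eq_bigr => M MP.
  rewrite [RHS](partition_big p (mem A)) /=; last first.
    by move=> s sM; have [] := pmatchings_edge MP sM.
  apply: eq_bigr => i iA; apply: eq_bigl => s; rewrite inE.
  have [sM|] := boolP (s \in M); last by rewrite andbF.
  by have [-> _ ->] := pmatchings_edge MP sM; rewrite !andbT.
rewrite big_split /= swap -mulr_sumr mulr_natl -sumr_const -big_split /=.
rewrite -mulrA mulrCA mulr_natl -sumr_const.
(* From here the inequality is proved for each matching separately. *)
apply: ler_sum => M MP.
apply: (@le_trans _ _ (\sum_(i in A) ln #|edges_at B i|%:R + \sum_(s in M)
    \sum_(k in A | k != p s) h #|edges_at (B :\ q s) k|)).
  rewrite lerD2l; apply: ler_sum => s sM.
  (* [M] itself passes through [s]. Positivity serves both the monotonicity of [ln] and the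
     nonemptiness required by the induction hypothesis. *)
  have c0 : (0 < c s)%N by rewrite card_gt0; apply/set0Pn; exists M; rewrite inE MP.
  have cle : (c s <= #|pmatchings (A :\ p s) (B :\ q s)|)%N := card_pmatchings_edge A B s.
  apply: (@le_trans _ _ (ln #|pmatchings (A :\ p s) (B :\ q s)|%:R)).
    by rewrite ler_ln ?posrE ?ltr0n ?ler_nat // (leq_trans c0).
  have [_ psA _] := pmatchings_edge MP sM.
  apply: (le_trans (IH _ _ _ (leq_trans c0 cle))).
    by have := cardsD1 (p s) A; rewrite psA cA => -[].
  rewrite [leRHS](eq_bigl (fun k => k \in A :\ p s)) // => k.
  by rewrite in_setD1 andbC.
(* Exchanging the sums collects, for each row [k], its weights in all the minors obtained from edges
   of [M] outside row [k]. *)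
rewrite (exchange_big_dep (mem A)) /=; last by move=> s k _ /andP[].
rewrite -big_split mulr_sumr /=; apply: ler_sum => k kA.
rewrite -cA; apply: (le_trans _ (sum_minor_weights h A B M k MP kA hh)).
rewrite lerD2l [leRHS](eq_bigl (fun s => [&& s \in M, k \in A & k != p s])) // => s.
by rewrite kA eq_sym.
Qed.

End Matchings.

Arguments pmatchings {S I J} F p q A B.
Arguments edges_at {S I J} F p q B i.

(** * Across and down words as partitions of the white squares *)

Section Words.

(** Two overlapping maximal runs both equal their union, hence each other; singleton runs extend to
    maximal ones that cover [E]. *)
Lemma partition_maxset (T : finType) (run : pred {set T}) (E : {set T}) :
  (forall W, run W -> W != set0 /\ W \subset E) ->
  {in E, forall s, run [set s]} ->
  (forall W1 W2, run W1 -> run W2 -> ~~ [disjoint W1 & W2] -> run (W1 :|: W2)) ->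
  partition [set W | maxset run W] E.
Proof.
move=> runE run1 runU; apply/and3P; split.
- rewrite eqEsubset; apply/andP; split.
    apply/bigcupsP => W; rewrite inE => /maxsetp /runE[_ //].
  apply/subsetP => s sE; have [W Wmax sW] := maxset_exists (run1 s sE).
  by apply/bigcupP; exists W; rewrite ?inE // -sub1set.
- apply/trivIsetP => V W; rewrite !inE => Vmax Wmax; apply: contraR => VW.
  have rU := runU _ _ (maxsetp Vmax) (maxsetp Wmax) VW.
  have [_ /(_ _ rU (subsetUl V W)) VU] := maxsetP Vmax.
  have [_ /(_ _ rU (subsetUr V W)) WU] := maxsetP Wmax.
  by rewrite -VU WU.
- by rewrite inE; apply/negP => /maxsetp /runE[]; rewrite eqxx.
Qed.

(** Existence of a common point with each block gives surjectivity, its uniqueness gives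
    injectivity. *)
Lemma pblock_transversal (T : finType) (P : {set {set T}}) (E M : {set T}) :
  partition P E -> M \subset E -> {in P, forall W, #|M :&: W| = 1%N} ->
  pblock P @: M = P /\ {in M &, injective (pblock P)}.
Proof.
move=> /and3P[/eqP covP tiP _] ME M1.
have inP s : s \in M -> s \in cover P by rewrite covP; apply: subsetP.
split.
- apply/setP => W; apply/imsetP/idP => [[s sM ->]|WP].
    by rewrite pblock_mem ?inP.
  have /eqP/cards1P[s E1] := M1 W WP.
  have : s \in M :&: W by rewrite E1 set11.
  rewrite inE => /andP[sM sW]; exists s => //.
  by rewrite (def_pblock tiP WP sW).
- move=> s t sM tM st; have WP : pblock P s \in P by rewrite pblock_mem ?inP.
  have /eqP/cards1P[u E1] := M1 _ WP.
  have /set1P -> : s \in [set u] by rewrite -E1 inE sM mem_pblock inP.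
  have /set1P -> // : t \in [set u] by rewrite -E1 inE tM st mem_pblock inP.
Qed.

Variables m n : nat.
Implicit Types (G : grid m n) (W : {set 'I_m * 'I_n}).

Lemma white_row_runP G W :
  reflect [/\ W != set0, W \subset white G & exists i j k, W = row_segment i j k]
          (white_row_run G W).
Proof.
apply: (iffP and3P) => -[W0 WG run]; split => //.
  by have /existsP[i /existsP[j /existsP[k /eqP]]] := run; exists i, j, k.
have [i [j [k E]]] := run.
by apply/existsP; exists i; apply/existsP; exists j; apply/existsP; exists k; apply/eqP.
Qed.

Lemma white_col_runP G W :
  reflect [/\ W != set0, W \subset white G & exists j i k, W = col_segment j i k]
          (white_col_run G W).
Proof.
apply: (iffP and3P) => -[W0 WG run]; split => //.
  by have /existsP[i /existsP[j /existsP[k /eqP]]] := run; exists i, j, k.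
have [i [j [k E]]] := run.
by apply/existsP; exists i; apply/existsP; exists j; apply/existsP; exists k; apply/eqP.
Qed.

(** A shared square forces equal rows and leaves no gap, so the union runs from the smaller left end
    to the larger right end. *)
Lemma row_segmentU (i i' : 'I_m) (j k j' k' : 'I_n) :
  ~~ [disjoint row_segment i j k & row_segment i' j' k'] ->
  exists l r, row_segment i j k :|: row_segment i' j' k' = row_segment i l r.
Proof.
case/pred0Pn => -[a b]; rewrite !inE /= => /andP[/andP[/eqP <- jbk] /andP[/eqP <- jbk']].
exists (if (j <= j')%N then j else j'), (if (k <= k')%N then k' else k).
apply/setP => -[c d]; rewrite !inE /=; case: (c == a) => //=.
by case: (leqP j j'); case: (leqP k k') => ? ?; lia.
Qed.

Lemma col_segmentU (j j' : 'I_n) (i k i' k' : 'I_m) :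
  ~~ [disjoint col_segment j i k & col_segment j' i' k'] ->
  exists l r, col_segment j i k :|: col_segment j' i' k' = col_segment j l r.
Proof.
case/pred0Pn => -[b a]; rewrite !inE /= => /andP[/andP[/eqP <- jbk] /andP[/eqP <- jbk']].
exists (if (i <= i')%N then i else i'), (if (k <= k')%N then k' else k).
apply/setP => -[d c]; rewrite !inE /=; case: (c == a) => //=.
by case: (leqP i i'); case: (leqP k k') => ? ?; lia.
Qed.

Lemma setU_neq0 (T : finType) (V W : {set T}) : V != set0 -> V :|: W != set0.
Proof. by apply: contra; rewrite setU_eq0 => /andP[]. Qed.

Lemma across_words_partition G : partition (across_words G) (white G).
Proof.
apply: partition_maxset => [W /white_row_runP[]//|[i j] sG|].
  apply/white_row_runP; split; rewrite ?sub1set //.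
    by apply/set0Pn; exists (i, j); rewrite inE.
  exists i, j, j; apply/setP => -[a b]; rewrite !inE /= -eqn_leq xpair_eqE.
  by rewrite [RHS]andbC andbC [(b == j)]eq_sym.
move=> V W /white_row_runP[V0 VG [i [j [k VE]]]] /white_row_runP[_ WG [i' [j' [k' WE]]]] VW.
apply/white_row_runP; split; first exact: setU_neq0.
  by rewrite subUset VG.
move: VW; rewrite VE WE => /row_segmentU[l [r ->]].
by exists i, l, r.
Qed.

Lemma down_words_partition G : partition (down_words G) (white G).
Proof.
apply: partition_maxset => [W /white_col_runP[]//|[i j] sG|].
  apply/white_col_runP; split; rewrite ?sub1set //.
    by apply/set0Pn; exists (i, j); rewrite inE.
  exists j, i, i; apply/setP => -[a b]; rewrite !inE /= -eqn_leq xpair_eqE.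
  by rewrite andbC [(a == i)]eq_sym.
move=> V W /white_col_runP[V0 VG [i [j [k VE]]]] /white_col_runP[_ WG [i' [j' [k' WE]]]] VW.
apply/white_col_runP; split; first exact: setU_neq0.
  by rewrite subUset VG.
move: VW; rewrite VE WE => /col_segmentU[l [r ->]].
by exists i, l, r.
Qed.

(** Excludes parallel edges: an across word fixes the row and a down word the column. *)
Lemma pblock_across_down_inj G : {in white G &, forall s t,
  pblock (across_words G) s = pblock (across_words G) t ->
  pblock (down_words G) s = pblock (down_words G) t -> s = t}.
Proof.
move=> s t sG tG.
have /and3P[/eqP cA _ _] := across_words_partition G.
have /and3P[/eqP cD _ _] := down_words_partition G.
move=> pst qst.
have : s.1 = t.1.
  have : pblock (across_words G) s \in across_words G by rewrite pblock_mem ?cA.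
  rewrite inE => /maxsetp /white_row_runP[_ _ [i [j [k E]]]].
  have : t \in row_segment i j k by rewrite -E pst mem_pblock cA.
  have : s \in row_segment i j k by rewrite -E mem_pblock cA.
  by rewrite !inE => /andP[/eqP -> _] /andP[/eqP -> _].
have : s.2 = t.2.
  have : pblock (down_words G) s \in down_words G by rewrite pblock_mem ?cD.
  rewrite inE => /maxsetp /white_col_runP[_ _ [i [j [k E]]]].
  have : t \in col_segment i j k by rewrite -E qst mem_pblock cD.
  have : s \in col_segment i j k by rewrite -E mem_pblock cD.
  by rewrite !inE => /andP[/eqP -> _] /andP[/eqP -> _].
by case: s t {sG tG pst qst} => [a b] [c d] /= -> ->.
Qed.

(** A placement is a transversal of both partitions, so an upper bound for matchings transfers to
    placements. *)
Lemma RP_sub_pmatchings G :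
  RP G \subset pmatchings (white G) (pblock (across_words G))
    (pblock (down_words G)) (across_words G) (down_words G).
Proof.
apply/subsetP => M; rewrite inE => /and3P[MG /forall_inP MA /forall_inP MD].
have [pA injA] := pblock_transversal _ _ _ _ (across_words_partition G) MG
  (fun W WP => eqP (MA W WP)).
have [qD injD] := pblock_transversal _ _ _ _ (down_words_partition G) MG
  (fun W WP => eqP (MD W WP)).
exact/pmatchingsP.
Qed.

(** Every white square lies in some down word, so the edges at [W] are exactly its squares. *)
Lemma card_edges_at_word G W : W \in across_words G ->
  #|edges_at (white G) (pblock (across_words G)) (pblock (down_words G))
      (down_words G) W| = #|W|.
Proof.
have /and3P[/eqP cA tA _] := across_words_partition G.
have /and3P[/eqP cD tD _] := down_words_partition G.
move=> WA; apply: eq_card => s; rewrite inE.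
have [sG|sG] := boolP (s \in white G); last first.
  apply/esym/negP => sW; move/negP: sG; apply.
  by rewrite -cA; apply/bigcupP; exists W.
rewrite pblock_mem ?cD // andbT; apply/eqP/idP => [<-|sW].
  by rewrite mem_pblock cA.
exact: def_pblock.
Qed.

End Words.

(** * Strict concavity of the exponent and its critical point *)

Section Exponent.
Variable R : realType.
Implicit Types x y c z : R.

Let f : R -> R := @rook_exponent R.

(** First derivative of [rook_exponent] on the positive reals; [rook_curvature] is the second. *)
Definition rook_slope x : R := - (1 + 2 * x) * ln x + x - 2.

Definition rook_curvature x : R := - 2 * ln x - x^-1 - 1.

Lemma is_derive_rook_exponent x : 0 < x -> is_derive x 1 f (rook_slope x).
Proof.
move=> x0; rewrite /f /rook_exponent.
have dln := is_derive1_ln x0.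
apply: is_derive_eq.
rewrite /rook_slope /GRing.scale /=; field.
exact: lt0r_neq0.
Qed.

Lemma is_derive_rook_slope x : 0 < x -> is_derive x 1 rook_slope (rook_curvature x).
Proof.
move=> x0; rewrite /rook_slope.
have dln := is_derive1_ln x0.
apply: is_derive_eq.
rewrite /rook_curvature /GRing.scale /=; field.
exact: lt0r_neq0.
Qed.

Lemma MVT_pos (g dg : R -> R) x y : 0 < x -> x < y ->
  (forall z, 0 < z -> is_derive z 1 g (dg z)) ->
  exists2 c, x < c < y & g y - g x = dg c * (y - x).
Proof.
move=> x0 xy gd; have [||c + E] := @MVT R g dg x y xy.
- by move=> z; rewrite in_itv /= => /andP[xz _]; apply/gd/(lt_trans x0).
- apply: derivable_within_continuous => z; rewrite in_itv /= => /andP[xz _].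
  by have [] := gd z (lt_le_trans x0 xz).
by rewrite in_itv /= => ?; exists c.
Qed.

Lemma ln_le_subr1 x : 0 < x -> ln x <= x - 1.
Proof. by move=> x0; have := @le_ln1Dx R (x - 1); rewrite addrCA subrr addr0; apply; lra. Qed.

Lemma ln_ge_1subV x : 0 < x -> 1 - x^-1 <= ln x.
Proof.
move=> x0; have := @ln_le_subr1 x^-1; rewrite invr_gt0 lnV ?posrE // => /(_ x0); lra.
Qed.

(** Applying ln y >= 1 - 1/y at y = 2x cancels the term 1/x and leaves the bound 2 ln 2 - 3, which
    is negative since ln 2 <= 1. *)
Lemma rook_curvature_lt0 x : 0 < x -> rook_curvature x < 0.
Proof.
move=> x0; have := ln_ge_1subV (2 * x); have := ln_le_subr1 2 ltac:(lra).
rewrite mulr_gt0 // /rook_curvature lnM ?posrE // invfM => l2 /(_ isT); lra.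
Qed.

Lemma rook_slope_decr x y : 0 < x -> x < y -> rook_slope y < rook_slope x.
Proof.
move=> x0 xy; have [c /andP[xc _] E] := MVT_pos _ _ _ _ x0 xy is_derive_rook_slope.
by rewrite -subr_lt0 E pmulr_llt0 ?subr_gt0 // rook_curvature_lt0 // (lt_trans x0 xc).
Qed.

(** The mean slope between [x] and [c] is attained strictly between them, where strict decrease of
    the slope separates it from the slope at [c]. *)
Lemma rook_exponent_lt_tangent c x : 0 < c -> 0 < x -> x != c ->
  f x < f c + rook_slope c * (x - c).
Proof.
move=> c0 x0; rewrite neq_lt => /orP[xc|cx].
  have [z /andP[xz zc] E] := MVT_pos _ _ _ _ x0 xc is_derive_rook_exponent.
  have := rook_slope_decr _ _ (lt_trans x0 xz) zc; nra.
have [z /andP[cz zx] E] := MVT_pos _ _ _ _ c0 cx is_derive_rook_exponent.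
have := rook_slope_decr _ _ c0 cz; nra.
Qed.

Lemma rook_exponent_le_tangent c x : 0 < c -> 0 < x ->
  f x <= f c + rook_slope c * (x - c).
Proof.
move=> c0 x0; have [->|xc] := eqVneq x c; first by rewrite subrr mulr0 addr0.
exact/ltW/rook_exponent_lt_tangent.
Qed.

Lemma rook_slope_root : exists2 x, 0 < x < 1 & rook_slope x = 0.
Proof.
have s1 : rook_slope 1 = -1 by rewrite /rook_slope ln1; ring.
(* Here the logarithm is -2, so the slope reduces to 5a > 0, against -1 at the point 1. *)
set a : R := expR (- 2).
have a0 : 0 < a by exact: expR_gt0.
have a1 : a <= 1 by rewrite /a -[leRHS]expR0 ler_expR; lra.
have sa : rook_slope a = 5 * a by rewrite /rook_slope expRK; ring.
have [||x] := @IVT R rook_slope a 1 0 a1.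
- apply: derivable_within_continuous => z; rewrite in_itv /= => /andP[az _].
  by have [] := is_derive_rook_slope z (lt_le_trans a0 az).
- by rewrite ge_min le_max s1 sa; apply/andP; split; apply/orP; [right|left]; lra.
rewrite in_itv /= => /andP[ax x1] sx; exists x => //.
rewrite (lt_le_trans a0 ax) lt_neqAle x1 andbT.
by apply/eqP => xE; move: sx; rewrite xE s1; lra.
Qed.

End Exponent.

(** * Numerical enclosure of the maximum *)

Section Numerics.
Variable R : realType.
Implicit Types x y c z : R.

(* Truncated Taylor series of [2 artanh z = ln ((1 + z) / (1 - z))]. *)
Definition artanh_sum (n : nat) z : R :=
  \sum_(k < n) 2 / (2 * k + 1)%:R * z ^+ (2 * k + 1).

Lemma is_derive_artanh_sum n z :
  is_derive z 1 (artanh_sum n) (\sum_(k < n) 2 * z ^+ (2 * k)).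
Proof.
elim: n => [|n IH].
  have -> : artanh_sum 0 = cst 0 by apply/funext => t; rewrite /artanh_sum big_ord0.
  by rewrite big_ord0; exact: is_derive_cst.
have -> : artanh_sum n.+1 =
    artanh_sum n + (fun t => 2 / (2 * n + 1)%:R * t ^+ (2 * n + 1)).
  by apply/funext => t; rewrite /artanh_sum big_ord_recr.
rewrite big_ord_recr /=; apply: is_deriveD; rewrite addn1.
have dX : is_derive z 1 (fun t : R => t ^+ (2 * n).+1)
    ((2 * n).+1%:R * z ^+ (2 * n)).
  have := @is_deriveX R R id (2 * n).+1 z 1 1 (is_derive_id z 1).
  by rewrite exprfctE /GRing.scale /= mulr1.
apply: is_derive_eq (is_deriveZ (2 / (2 * n).+1%:R) dX) _.
by rewrite /GRing.scale /= mulrA divfK // pnatr_eq0.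
Qed.

Lemma geometric_sum_sqr n z : z ^+ 2 != 1 ->
  \sum_(k < n) 2 * z ^+ (2 * k) = 2 * (1 - z ^+ (2 * n)) / (1 - z ^+ 2).
Proof.
move=> z1; have z1' : 1 - z ^+ 2 != 0 by rewrite subr_eq0 eq_sym.
elim: n => [|n IH]; first by rewrite big_ord0 muln0 expr0 subrr mulr0 mul0r.
rewrite big_ord_recr /= IH mulnS exprD; field; exact: z1'.
Qed.

(** The error [g] vanishes at 0, and its derivative [dg] is the tail of a geometric series,
    nonnegative and nondecreasing on [0, z]. The mean value theorem bounds the error by z times
    [dg z]. *)
Lemma ln_artanh_sum n z : 0 < z < 1 ->
  artanh_sum n z <= ln ((1 + z) / (1 - z)) <=
    artanh_sum n z + 2 * z ^+ (2 * n + 1) / (1 - z ^+ 2).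
Proof.
move=> /andP[z0 z1].
rewrite ln_div ?posrE; [|lra|lra].
pose g (t : R) : R := ln (1 + t) - ln (1 - t) - artanh_sum n t.
pose dg (t : R) : R := 2 * t ^+ (2 * n) / (1 - t ^+ 2).
have dgE (t : R) : -1 < t < 1 -> is_derive t 1 g (dg t).
  move=> /andP[t0 t1].
  have d1 : is_derive t 1 (fun t : R => ln (1 + t)) (1 + t)^-1.
    have dl : is_derive (1 + t) 1 (@ln R) (1 + t)^-1 by apply: is_derive1_ln; lra.
    have da : is_derive t 1 (fun t : R => 1 + t) 1.
      by have := is_deriveD (is_derive_cst (1 : R) t 1) (is_derive_id t 1); rewrite add0r.
    by apply: is_derive_eq (is_derive1_comp dl da) _; rewrite /GRing.scale /= mulr1.
  have d2 : is_derive t 1 (fun t : R => ln (1 - t)) (- (1 - t)^-1).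
    have dl : is_derive (1 - t) 1 (@ln R) (1 - t)^-1 by apply: is_derive1_ln; lra.
    have da : is_derive t 1 (fun t : R => 1 - t) (-1).
      by have := is_deriveB (is_derive_cst (1 : R) t 1) (is_derive_id t 1); rewrite sub0r.
    apply: is_derive_eq (@is_derive1_comp R (@ln R) (fun t : R => 1 - t) t _ _ dl da) _.
    by rewrite mulrN1.
  have dS := is_derive_artanh_sum n t.
  apply: is_derive_eq.
  have t2 : t ^+ 2 != 1 by apply/eqP => E; nra.
  rewrite geometric_sum_sqr // /dg; field.
  by rewrite subr_eq0 eq_sym t2 /=; apply/andP; split; apply/lt0r_neq0; lra.
have g0 : g 0 = 0.
  rewrite /g addr0 subr0 subrr sub0r /artanh_sum big1 ?oppr0 // => k _.
  by rewrite addn1 expr0n mulr0.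
have [||t + E] := @MVT R g dg 0 z z0.
- by move=> t; rewrite in_itv /= => /andP[t0 t1]; apply: dgE; lra.
- apply: derivable_within_continuous => t; rewrite in_itv /= => /andP[t0 t1].
  have td : -1 < t < 1 by lra.
  by have [] := dgE t td.
rewrite in_itv /= => /andP[t0 tz].
have tp : 0 <= t ^+ (2 * n) by rewrite exprn_ge0 // ltW.
have tzp : t ^+ (2 * n) <= z ^+ (2 * n) by rewrite lerXn2r // ?nnegrE; apply/ltW => //; lra.
have t2 : 0 < 1 - t ^+ 2 by nra.
have z2 : 0 < 1 - z ^+ 2 by nra.
have dt0 : 0 <= dg t by rewrite /dg divr_ge0 ?mulr_ge0 // ltW.
have dt1 : dg t <= 2 * z ^+ (2 * n) / (1 - z ^+ 2).
  rewrite /dg ler_pM ?mulr_ge0 ?invr_ge0 ?ler_pM2l //; first exact: ltW.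
  by rewrite lef_pV2 ?posrE //; nra.
move: E; rewrite g0 !subr0 /g addn1 exprSr => E.
apply/andP; split; first nra.
suff : dg t * z <= 2 * (z ^+ (2 * n) * z) / (1 - z ^+ 2) by lra.
rewrite (_ : _ / _ = 2 * z ^+ (2 * n) / (1 - z ^+ 2) * z); last by ring.
by rewrite ler_pM2r.
Qed.

(* The maximum of [rook_exponent] is attained near [0.42987], so [43 / 100] is
   close enough for tangent-line bounds; [57 / 143 = (1 - 0.43) / (1 + 0.43)]. *)
Lemma ln43_bounds :
  - (843 / 10 ^+ 3 + 972 / 10 ^+ 6) <= ln (43 / 100 : R) <=
  - (843 / 10 ^+ 3 + 969 / 10 ^+ 6).
Proof.
(* Eight terms leave a remainder below 1 / 10 ^ 6. *)
have := @ln_artanh_sum 8 (57 / 143) ltac:(lra).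
have -> : (1 + 57 / 143) / (1 - 57 / 143) = (43 / 100 : R)^-1 by field.
rewrite lnV ?posrE; last by lra.
rewrite /artanh_sum !big_ord_recr big_ord0 /=.
rewrite !addn1 !mul2n.
have -> : 1 - (57 / 143) ^+ 2 = (172 / 143) * (100 / 143) :> R by field.
rewrite /double /=; lra.
Qed.

(** Sharp enough to make the slope positive at 42/100. *)
Lemma ln42_ub : ln (42 / 100 : R) <= - 867 / 1000.
Proof.
have -> : 42 / 100 = (43 / 100) * (42 / 43) :> R by field.
rewrite lnM ?posrE; [|lra|lra].
have := @ln_le_subr1 R (42 / 43) ltac:(lra).
have := ln43_bounds; lra.
Qed.

(** Signs of the slope place [c] between 42/100 and 43/100. The horizontal tangent at [c] gives the
    lower bound; the tangent at 43/100, nearly flat, exceeds f(43/100) by less than 3 / 10 ^ 6 at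
    [c]. *)
Lemma rook_exponent_max_bounds c : 0 < c < 1 -> rook_slope R c = 0 ->
  `|@rook_exponent R c - (27 / 10 ^+ 2 + 386 / 10 ^+ 5)| <= 5 / 10 ^+ 6.
Proof.
move=> /andP[c0 c1] sc.
have L := ln43_bounds; have L' := ln42_ub.
have f43 : @rook_exponent R (43 / 100) =
   43 / 100 * (- (143 / 100) * ln (43 / 100) - 57 / 100) by rewrite /rook_exponent; field.
have s43 : rook_slope R (43 / 100) = - (186 / 100) * ln (43 / 100) - 157 / 100.
  by rewrite /rook_slope; field.
have s42 : rook_slope R (42 / 100) = - (184 / 100) * ln (42 / 100) - 158 / 100.
  by rewrite /rook_slope; field.
have lb := @rook_exponent_le_tangent R c (43 / 100) c0 ltac:(lra).
have ub := @rook_exponent_le_tangent R (43 / 100) c ltac:(lra) c0.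
have cgt : 42 / 100 < c.
  rewrite ltNge; apply/negP; rewrite le_eqVlt => /predU1P[cE|clt].
    by move: sc s42; rewrite cE => ->; lra.
  by have := @rook_slope_decr R _ _ c0 clt; rewrite sc s42; lra.
have clt : c < 43 / 100.
  rewrite ltNge; apply/negP; rewrite le_eqVlt => /predU1P[cE|clt].
    by move: sc s43; rewrite -cE => ->; lra.
  by have := @rook_slope_decr R (43 / 100) c ltac:(lra) clt; rewrite sc s43; lra.
rewrite ler_norml; apply/andP; split.
  by move: lb; rewrite sc mul0r addr0; lra.
nra.
Qed.

End Numerics.

(** * Word weights and their sum over a partition *)

Section Weights.
Variable R : realType.

Let f : R -> R := @rook_exponent R.

(** For r > 0, r times this weight is r ln r - r + 1 + ln r: the integral of ln over [1, r] plus ln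
    r, an upper bound for the logarithm of r factorial. *)
Definition word_weight (r : nat) : R := r%:R * f r%:R^-1.

(** For x = r > 0 the claim reduces to 1 <= (x + 1)(ln (x + 1) - ln x), which is ln u >= 1 - 1/u at
    u = (x + 1) / x. For r = 0 both sides vanish. *)
Lemma word_weight_rec r :
  r%:R * word_weight r + ln r.+1%:R <= r.+1%:R * word_weight r.+1.
Proof.
rewrite /word_weight; case: r => [|r].
  by rewrite !mul0r !mul1r invr1 /f /rook_exponent ln1; lra.
set x : R := r.+1%:R; rewrite (_ : r.+2%:R = x + 1 :> R); last by rewrite /x [RHS]natr1.
have x0 : 0 < x by rewrite ltr0n.
have x1 : 0 < x + 1 by lra.
have E y : 0 < y -> y * (y * f y^-1) = y * ln y + ln y - y + 1.
  move=> y0; rewrite /f /rook_exponent lnV ?posrE //; field; exact: lt0r_neq0.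
rewrite !E //.
have := @ln_ge_1subV R ((x + 1) / x); rewrite divr_gt0 // => /(_ isT).
rewrite ln_div ?posrE // invf_div => H.
have : (x + 1) * (1 - x / (x + 1)) <= (x + 1) * (ln (x + 1) - ln x) by rewrite ler_pM2l.
rewrite mulrBr mulr1 mulrCA divff ?mulr1 ?lt0r_neq0 //; lra.
Qed.

(** Scaling the tangent inequality at 1/r by r makes the bound affine in r, so its sum over words
    sees only the numbers of squares and of words. *)
Lemma word_weight_le_tangent c r : 0 < c ->
  word_weight r.+1 <= r.+1%:R * (f c - rook_slope R c * c) + rook_slope R c.
Proof.
move=> c0; have r0 : 0 < r.+1%:R :> R by rewrite ltr0n.
have := @rook_exponent_le_tangent R c r.+1%:R^-1 c0.
rewrite invr_gt0 => /(_ r0); rewrite -(ler_pM2l r0) /word_weight => /le_trans; apply.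
rewrite /f le_eqVlt; apply/orP; left; apply/eqP; field.
by rewrite addrC natr1 lt0r_neq0.
Qed.

(** Jensen's inequality: with the tangent taken at c = [#|P|] / [#|E|], the slope terms cancel in
    the total. *)
Lemma sum_word_weight_le (T : finType) (P : {set {set T}}) (E : {set T}) :
  partition P E -> (0 < #|E|)%N ->
  \sum_(W in P) word_weight #|W| <= #|E|%:R * f (#|P|%:R / #|E|%:R).
Proof.
move=> PE E0; have cE := card_partition PE.
have P0 : (0 < #|P|)%N.
  rewrite card_gt0; apply: contraTneq E0 => P0.
  by rewrite cE P0 big_set0.
set N : R := #|E|%:R; set c := _ / N.
have N0 : 0 < N by rewrite ltr0n.
have c0 : 0 < c by rewrite divr_gt0 ?ltr0n.
apply: (@le_trans _ _ (\sum_(W in P)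
    (#|W|%:R * (f c - rook_slope R c * c) + rook_slope R c))).
  apply: ler_sum => W WP.
  have : (0 < #|W|)%N.
    rewrite card_gt0; apply: contraTneq WP => ->.
    by have /and3P[] := PE.
  by case: #|W| => // r _; exact: word_weight_le_tangent.
rewrite big_split /= -mulr_suml -natr_sum -cE sumr_const -[rook_slope R c *+ _]mulr_natl.
rewrite (_ : #|P|%:R = c * N); last by rewrite divfK ?lt0r_neq0.
rewrite -/N; lra.
Qed.

Lemma rook_boundE (N a : nat) : (0 < N)%N -> (0 < a)%N ->
  ((N%:R / a%:R) `^ (1 + a%:R / N%:R) * expR (a%:R / N%:R - 1)) ^+ a =
  expR (N%:R * f (a%:R / N%:R)).
Proof.
move=> N0 a0.
have Np : 0 < N%:R :> R by rewrite ltr0n.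
have ap : 0 < a%:R :> R by rewrite ltr0n.
rewrite /powR gt_eqF ?divr_gt0 // -expRD -expRM_natl; congr expR.
rewrite /f /rook_exponent !ln_div ?posrE //; field.
exact: lt0r_neq0.
Qed.

End Weights.

(** * From matchings to the two bounds on rook placements *)

Theorem proposition2p3 (R : realType) :
  exists C : R,
    [/\ unique_max_on (@rook_exponent R) 0 1 C,
        `|C - (27 / 10 ^+ 2 + 386 / 10 ^+ 5)| <= 5 / 10 ^+ 6 &
        forall (m n : nat) (G : grid m n), (0 < m)%N -> (0 < n)%N ->
          (1 <= #|white G|)%N ->
          let N : R := #|white G|%:R in
          let a : R := #|across_words G|%:R in
          let B : R :=
            ((N / a) `^ (1 + a / N) * expR (a / N - 1)) ^+ #|across_words G| in
          #|RP G|%:R <= B /\ B <= expR (C * N)].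
Proof.
have [c /andP[c0 c1] sc] := rook_slope_root R.
(* Stated for all positive [x], since a/N equals 1 when every across word is a single square. *)
have fmax x : 0 < x -> rook_exponent x <= rook_exponent c.
  by move=> x0; have := @rook_exponent_le_tangent R c x c0 x0; rewrite sc mul0r addr0.
exists (rook_exponent c); split.
- exists c; split; rewrite ?c0 // => x /andP[x0 _] xc.
  by have := @rook_exponent_lt_tangent R c x c0 x0 xc; rewrite sc mul0r addr0.
- by apply: rook_exponent_max_bounds => //; rewrite c0.
move=> m n G _ _ N0 N a B.
have PA := across_words_partition _ _ G.
have a0 : (0 < #|across_words G|)%N.
  rewrite card_gt0; apply: contraTneq N0 => A0.
  by rewrite (card_partition PA) A0 big_set0.
have BE : B = expR (N * rook_exponent (a / N)) by exact: rook_boundE.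
have Np : 0 < N by rewrite ltr0n.
rewrite BE; split; last first.
  by rewrite ler_expR mulrC ler_pM2r // fmax // divr_gt0 ?ltr0n.
(* Logarithms are compared only when a placement exists; otherwise the bound is nonnegative. *)
have [->|RP0] := posnP #|RP G|; first exact: expR_ge0.
have RPle : (#|RP G| <= #|pmatchings (white G) (pblock (across_words G))
    (pblock (down_words G)) (across_words G) (down_words G)|)%N.
  exact/subset_leq_card/RP_sub_pmatchings.
have P0 := leq_trans RP0 RPle.
have P0R : 0 < #|RP G|%:R :> R by rewrite ltr0n.
have := ln_card_pmatchings_le _ _ _ _ _ _ (pblock_across_down_inj _ _ G) R _ _ _
  (@word_weight_rec R) P0.
under eq_bigr => W WA do rewrite card_edges_at_word //.
move=> /le_trans/(_ (sum_word_weight_le _ _ _ _ PA N0)) H.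
rewrite -[leLHS]lnK ?posrE // ler_expR (le_trans _ H) //.
by rewrite ler_ln ?posrE ?ltr0n // ler_nat.
Qed.
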